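(* Let $n\geq 9$ be an integer and let $F$ be a forest of order $n$. Then $Z_1(F)\leq Z_1(P_n)$, with equality if and only if $F$ is (isomorphic to) the path $P_n$.
   Context: All graphs are finite, simple and undirected. The order of a graph is its number of vertices. For a graph $G$, a $1$-nearly independent edge subset of $G$ is a subset $I\subseteq E(G)$ that contains exactly one (unordered) pair of adjacent edges, i.e. exactly one pair of distinct edges of $I$ share a common end-vertex. $Z_1(G)$ denotes the number of $1$-nearly independent edge subsets of $G$. $P_n$ is the path with $n$ vertices. *)

(* Defs.v *)
From mathcomp Require Import all_boot.
Set Implicit Arguments. Unset Strict Implicit. Unset Printing Implicit Defensive.

Record sgraph (V : finType) := SGraph {
  adj :> rel V;
  adj_sym : symmetric adj;
  adj_irrefl : irreflexive adj }.

Section SimpleGraphs.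
Variable V : finType.
Implicit Types (G : sgraph V) (I : {set {set V}}).

(* An edge is the two-element set of its end-vertices. *)
Definition edges G : {set {set V}} :=
  [set [set p.1; p.2] | p : V * V & G p.1 p.2].

Definition adjacent_edges (e f : {set V}) : bool :=
  (e != f) && [exists v, (v \in e) && (v \in f)].

(* An unordered pair {e, f} is the set [set e; f], so it is counted once. *)
Definition adjacent_pairs I : {set {set {set V}}} :=
  [set [set p.1; p.2] | p : {set V} * {set V}
     & [&& p.1 \in I, p.2 \in I & adjacent_edges p.1 p.2]].

Definition nearly_independent1 G I : bool :=
  (I \subset edges G) && (#|adjacent_pairs I| == 1).

Definition Z1 G : nat := #|[set I | nearly_independent1 G I]|.

(* The bound on [size c] excludes the back-and-forth walks x, y, x, which
   [ucycle] accepts. *)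
Definition is_forest G : Prop :=
  ~ exists c : seq V, 2 < size c /\ ucycle G c.

End SimpleGraphs.

Definition isomorphic (V W : finType) (G : sgraph V) (H : sgraph W) : Prop :=
  exists f : V -> W, bijective f /\ forall x y, H (f x) (f y) = G x y.

Definition path_adj (n : nat) : rel 'I_n :=
  fun i j => (i.+1 == j :> nat) || (j.+1 == i :> nat).

Lemma path_adj_sym n : symmetric (@path_adj n).
Proof. by move=> i j; rewrite /path_adj orbC. Qed.

Lemma path_adj_irrefl n : irreflexive (@path_adj n).
Proof. by move=> i; rewrite /path_adj orbb -[X in _ == X]addn0 -addn1 eqn_add2l. Qed.

Definition path_graph (n : nat) : sgraph 'I_n :=
  SGraph (@path_adj_sym n) (@path_adj_irrefl n).

(* Main.v *)
Require Import Defs.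
From mathcomp Require Import all_boot zify ring.

Set Implicit Arguments. Unset Strict Implicit. Unset Printing Implicit Defensive.

(** The number of edge subsets with no adjacent pair (matchings) and the number
    with exactly one obey linked recurrences.  Splitting on whether a
    pendant edge uv, u the leaf, belongs to the subset gives, with m and z the
    two counts of the subgraph induced on A,
      m(A) = m(A - u) + m(A - u - v),
      z(A) = z(A - u) + z(A - u - v) + sum over x of m(A - u - v - x),
    x ranging over the neighbours of v other than u ([leaf_counts]).  For a path
    the sum has a single term, so m and z take the values f and a with
    f(n+2) = f(n+1) + f(n) and a(n+3) = a(n+2) + a(n+1) + f(n).

    In a forest with an edge, the second vertex v of a longest path has at most
    one neighbour w that is not a leaf ([penultimate]).  If some leaf u at v
    leaves v with at most w as a neighbour, the recurrence has the same shape as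
    for a path and induction gives z(A) <= a(n).  If v has further leaves, they
    become isolated in A - u - v, whose counts are then those of a
    smaller forest; this costs more than the longer sum can bring back
    ([many_leaves_bound]), and the inequality is strict.

    The induction cannot start at small orders: for each order from 4 to 7 some
    forest beats the path by one, for instance the star of order 4, and the
    path is not the only maximum at order 8.  Up to order 9 the bound is read
    off a table.  A forest with a chosen root r is, unless it has order one,
    obtained from two smaller rooted forests by adding an edge between the
    roots, or by mere union ([rooted_split]), and five numbers attached to a
    rooted forest determine those of the result ([join_counts]).  Hence finitely
    many quintuples arise and they can be enumerated ([small_profiles_ok]).  From
    order 10 on, an error of one at the orders below 8 is absorbed by the strict
    case.

    For equality, the numbers suffice until the last step: z(A) = a(n) forces
    m(A) = f(n) ([near1_leq]), and among forests only the path has that many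
    matchings ([matchings_leq]). *)

(** * Counting edge subsets by their adjacent pairs *)

Section EdgeSets.
Variable V : finType.
Implicit Types (e f : {set V}) (E F I J : {set {set V}}).

Definition nearly k E : nat :=
  #|[set I : {set {set V}} | (I \subset E) && (#|adjacent_pairs I| == k)]|.

(** What remains available once e has been put in a matching: the closed
    neighbourhood of e in the line graph is deleted. *)
Definition away e E : {set {set V}} :=
  [set f in E | (f != e) && ~~ adjacent_edges e f].

Lemma adjacent_edgesC e f : adjacent_edges e f = adjacent_edges f e.
Proof.
by rewrite /adjacent_edges eq_sym; congr andb; apply: eq_existsb => v; rewrite andbC.
Qed.

Lemma apart_edges e f v : v \in e -> (forall z, z \in e -> z \notin f) ->
  e != f /\ ~~ adjacent_edges e f.
Proof.
move=> ve apart; split; first by apply: contraNneq (apart v ve) => <-.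
rewrite /adjacent_edges negb_and; apply/orP; right; apply/existsPn=> z.
by apply/negP=> /andP[/apart/negP].
Qed.

Lemma adjacent_pairs0 : adjacent_pairs (set0 : {set {set V}}) = set0.
Proof.
apply/setP=> D; rewrite inE; apply/negP => /imsetP[p].
by rewrite !inE.
Qed.

Lemma adjacent_pairsU1 e J : e \notin J ->
  adjacent_pairs (e |: J) =
  adjacent_pairs J :|: [set [set e; f] | f in [set f in J | adjacent_edges e f]].
Proof.
move=> eJ; apply/setP=> D; apply/idP/idP.
- case/imsetP=> -[x y]; rewrite !inE /= => /and3P[]; case/predU1P=> [->|xJ].
    case/predU1P=> [->|yJ]; first by rewrite /adjacent_edges eqxx.
    move=> xy ->; apply/orP; right; apply/imsetP; exists y => //.
    by rewrite inE yJ.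
  case/predU1P=> [->|yJ] xy ->; apply/orP.
    right; apply/imsetP; exists x; last by rewrite setUC.
    by rewrite inE xJ adjacent_edgesC.
  left; apply/imsetP; exists (x, y) => //.
  by rewrite !inE /= xJ yJ.
- rewrite inE => /orP[] /imsetP.
    case=> -[x y]; rewrite !inE /= => /and3P[xJ yJ xy] ->.
    by apply/imsetP; exists (x, y); rewrite ?inE //= xJ yJ xy !orbT.
  case=> f; rewrite inE => /andP[fJ ef] ->.
  by apply/imsetP; exists (e, f); rewrite ?inE //= eqxx fJ ef orbT.
Qed.

(** The new pairs are the {e, f} with f in J adjacent to e, and f can be
    recovered from such a pair. *)
Lemma card_adjacent_pairsU1 e J : e \notin J ->
  #|adjacent_pairs (e |: J)| =
  #|adjacent_pairs J| + #|[set f in J | adjacent_edges e f]|.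
Proof.
move=> eJ; rewrite adjacent_pairsU1 // cardsU.
have -> : adjacent_pairs J :&: [set [set e; f] | f in [set f in J | adjacent_edges e f]] = set0.
  apply/setP=> D; rewrite !inE; apply/negP => /andP[/imsetP[[x y]]].
  rewrite inE /= => /and3P[xJ yJ _] -> /imsetP[f _ /setP/(_ e)].
  by rewrite !inE eqxx /= => /orP[] /eqP ee; rewrite ee ?xJ ?yJ in eJ.
rewrite cards0 subn0; congr (_ + _); apply: card_in_imset => f g.
rewrite !inE => /andP[fJ _] /andP[gJ _].
move/setP/(_ f); rewrite !inE eqxx orbT => /esym/orP[] /eqP // fe.
by rewrite -fe fJ in eJ.
Qed.

Lemma nearly_edge k E e : e \in E ->
  nearly k E = nearly k (E :\ e) +
   #|[set J : {set {set V}} | (J \subset E :\ e) &&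
       (#|adjacent_pairs J| + #|[set f in J | adjacent_edges e f]| == k)]|.
Proof.
move=> eE; rewrite {1}/nearly.
rewrite -(cardsID [set I : {set {set V}} | e \in I]) addnC; congr (_ + _).
  apply: eq_card => I; rewrite !inE subsetD1.
  by case: (e \in I); rewrite ?andbF //= !andbT.
rewrite -[RHS](@card_in_imset _ _ (fun J => e |: J)); last first.
  move=> I J; rewrite !inE !subsetD1 => /andP[/andP[_ eI] _] /andP[/andP[_ eJ] _].
  move=> /(congr1 (fun X => X :\ e)).
  by rewrite !setU1K.
apply: eq_card => I; rewrite !inE; apply/idP/imsetP.
- case/andP=> /andP[IE cI] eI; exists (I :\ e); last by rewrite setD1K.
  by rewrite inE setSD //= -card_adjacent_pairsU1 ?setD1K // setD11.
- case=> J; rewrite inE subsetD1 => /andP[/andP[JE eJ] cJ] ->.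
  by rewrite card_adjacent_pairsU1 // cJ setU11 subUset sub1set eE JE.
Qed.

Lemma sub_away e E J :
  (J \subset away e E) = (J \subset E :\ e) && (#|[set f in J | adjacent_edges e f]| == 0).
Proof.
apply/idP/andP.
- move/subsetP=> s; split.
    by apply/subsetP=> f /s; rewrite !inE => /and3P[-> -> _].
  rewrite cards_eq0; apply/eqP/setP=> f; rewrite !inE; apply/negP=> /andP[/s].
  by rewrite !inE => /and3P[_ _ /negPf->].
- case=> /subsetP s; rewrite cards_eq0 => /eqP/setP n; apply/subsetP=> f fJ.
  by move: (s f fJ) (n f); rewrite !inE fJ /= => /andP[-> ->] ->.
Qed.

Lemma nearly0_edge E e : e \in E ->
  nearly 0 E = nearly 0 (E :\ e) + nearly 0 (away e E).
Proof.
move=> eE; rewrite (nearly_edge _ eE); congr (_ + _); apply: eq_card => J.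
by rewrite !inE sub_away addn_eq0 -andbA; case: (J \subset _) => //=; rewrite andbC.
Qed.

(** A subset containing e has either its unique adjacent pair away from e, or
    this pair is {e, f}; in the second case the other members form a matching
    that avoids both e and f. *)
Lemma nearly1_edge E e : e \in E ->
  nearly 1 E = nearly 1 (E :\ e) + nearly 1 (away e E)
   + \sum_(f in E | adjacent_edges e f) nearly 0 (away f (away e E)).
Proof.
move=> eE; rewrite (nearly_edge _ eE) -addnA; congr (_ + _).
rewrite -(cardsID [set J : {set {set V}} | #|[set f in J | adjacent_edges e f]| == 0]).
congr (_ + _).
  apply: eq_card => J; rewrite !inE sub_away.
  case: (#|[set f in J | adjacent_edges e f]| =P 0) => [->|_].
    by rewrite addn0 !andbT.
  by rewrite !andbF.
pose P f := [set J : {set {set V}} | [&& J \subset E :\ e,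
   [set g in J | adjacent_edges e g] == [set f] & #|adjacent_pairs J| == 0]].
transitivity (\sum_(f in E | adjacent_edges e f) #|P f|).
  set Q := (X in #|X|).
  under [RHS]eq_bigr => f _ do rewrite -sum1_card.
  rewrite -sum1_card (exchange_big_dep (fun J => J \in Q)) /=; last first.
    move=> f J _; rewrite !inE => /and3P[-> /eqP-> /eqP->].
    by rewrite cards1.
  apply: eq_bigr => J; rewrite !inE => /andP[n0 /andP[JE c1]].
  have [f Jf] : exists f, [set g in J | adjacent_edges e g] = [set f].
    by apply/cards1P; move: n0 c1; case: #|_| => // -[|m]; rewrite // !addnS.
  have := set11 f; rewrite -Jf inE => /andP[fJ ef].
  rewrite (big_pred1 f) // => g; rewrite !inE.
  rewrite JE Jf /=; apply/idP/eqP => [/and3P[_ /eqP/setP/(_ f)]|->].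
    by rewrite !inE eqxx => /esym/eqP.
  move: c1; rewrite Jf cards1 addn1 eqSS => ->; rewrite eqxx ef !andbT.
  by have := subsetP JE f fJ; rewrite inE => /andP[_].
apply: eq_bigr => f /andP[fE ef].
have fe : f != e by move: ef; rewrite /adjacent_edges eq_sym => /andP[].
(* f |: K ranges over the subsets with adjacent pair {e, f} as K ranges over the
   matchings that avoid both. *)
have sub2 (K : {set {set V}}) : (K \subset away f (away e E)) =
    [&& K \subset E :\ e, f \notin K, [set g in K | adjacent_edges e g] == set0
      & [set g in K | adjacent_edges f g] == set0].
  rewrite sub_away subsetD1 sub_away !cards_eq0 -!andbA.
  by congr andb; rewrite andbCA.
rewrite /nearly -[RHS](@card_in_imset _ _ (fun K => f |: K)); last first.
  move=> I J; rewrite !inE !sub2 => /andP[/and4P[_ fI _ _] _] /andP[/and4P[_ fJ _ _] _].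
  move=> /(congr1 (fun X => X :\ f)).
  by rewrite !setU1K.
apply: eq_card => J; rewrite !inE; apply/and3P/imsetP.
- case=> JE /eqP Jf J0.
  have : f \in [set g in J | adjacent_edges e g] by rewrite Jf set11.
  rewrite inE => /andP[fJ _].
  exists (J :\ f); last by rewrite setD1K.
  have: #|adjacent_pairs (f |: (J :\ f))| == 0 by rewrite setD1K.
  rewrite card_adjacent_pairsU1 ?setD11 // addn_eq0 cards_eq0 [X in _ && X]cards_eq0.
  case/andP=> J1 J2; rewrite inE sub2 setD11 J2 cards_eq0 J1 !andbT /=.
  rewrite (subset_trans (subD1set _ _) JE) /=.
  apply/eqP/setP=> g; move/setP/(_ g): Jf; rewrite !inE.
  by case: (g == f) => //= ->.
- case=> K; rewrite inE sub2 => /andP[/and4P[KE fK /eqP Ke Kf] K0] ->; split.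
  + by rewrite subUset sub1set KE !inE fe fE.
  + apply/eqP/setP=> g; move/setP/(_ g): Ke; rewrite !inE.
    by case: (eqVneq g f) => [->|] //= _.
  + by rewrite card_adjacent_pairsU1 // addn_eq0 K0 cards_eq0 Kf.
Qed.

Lemma nearly_set0 k : nearly k set0 = (k == 0).
Proof.
rewrite /nearly; case: k => [|k] /=.
  rewrite -(cards1 (set0 : {set {set V}})); apply: eq_card => I; rewrite !inE subset0.
  by case: eqP => //= ->; rewrite adjacent_pairs0 cards0.
apply: eq_card0 => I; rewrite !inE subset0.
by case: eqP => //= ->; rewrite adjacent_pairs0 cards0.
Qed.

(** When no edge of E meets an edge of F, the unique adjacent pair lies on one
    side.  Induction on E by the recurrences avoids an explicit bijection
    between subsets of the union and pairs of subsets. *)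
Lemma nearlyU E F : (forall e f, e \in E -> f \in F -> e != f /\ ~~ adjacent_edges e f) ->
  nearly 0 (E :|: F) = nearly 0 E * nearly 0 F /\
  nearly 1 (E :|: F) = nearly 1 E * nearly 0 F + nearly 0 E * nearly 1 F.
Proof.
have [n] := ubnP #|E|; elim: n E => // n IH E /ltnSE leE sep.
have [->|[e eE]] := set_0Vmem E.
  by rewrite !nearly_set0 set0U !mul1n mul0n.
have eU : e \in E :|: F by rewrite inE eE.
have UD : (E :|: F) :\ e = E :\ e :|: F.
  apply/setP=> f; rewrite !inE andb_orr; congr orb.
  case fF: (f \in F); rewrite ?andbF ?andbT //.
  by case: (sep e f eE fF) => /negPf; rewrite eq_sym => ->.
have Uaway g (H : {set {set V}}) : g \in E -> H \subset E -> away g (H :|: F) = away g H :|: F.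
  move=> gE HE; apply/setP=> f; rewrite !inE andb_orl; congr orb.
  case fF: (f \in F); rewrite //=.
  by case: (sep g f gE fF) => /negPf; rewrite eq_sym => -> ->.
have aE g (H : {set {set V}}) : away g H \subset H by apply/subsetP=> x; rewrite inE => /andP[].
have IHs (H : {set {set V}}) : H \subset E :\ e -> nearly 0 (H :|: F) = nearly 0 H * nearly 0 F /\
  nearly 1 (H :|: F) = nearly 1 H * nearly 0 F + nearly 0 H * nearly 1 F.
  move=> HE; apply: IH.
    apply: leq_trans leE; rewrite (cardsD1 e E) eE ltnS; exact: subset_leq_card.
  by move=> x y /(subsetP HE); rewrite inE => /andP[_]; exact: sep.
have aDe : away e E \subset E :\ e.
  by apply/subsetP=> x; rewrite !inE => /and3P[-> ->].
have [D0 D1] := IHs _ (subxx _); have [A0 A1] := IHs _ aDe.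
split.
  by rewrite (nearly0_edge eU) (nearly0_edge eE) UD (Uaway e E) // D0 A0 mulnDl.
rewrite (nearly1_edge eU) UD (Uaway e E) // D1 A1 (nearly1_edge eE) (nearly0_edge eE).
have -> : \sum_(f in E :|: F | adjacent_edges e f) nearly 0 (away f (away e E :|: F)) =
  (\sum_(f in E | adjacent_edges e f) nearly 0 (away f (away e E))) * nearly 0 F.
  rewrite big_distrl /= (eq_bigl (fun f => (f \in E) && adjacent_edges e f)); last first.
    move=> f; rewrite inE andb_orl; case fF: (f \in F) => //=; last by rewrite orbF.
    by case: (sep e f eE fF) => _ /negPf->; rewrite andbF.
  apply: eq_bigr => f /andP[fE _]; rewrite (Uaway f) ?aE //.
  by have [-> _] := IHs _ (subset_trans (aE f _) aDe).
by rewrite !mulnDl; ring.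
Qed.
End EdgeSets.

(** * Induced subgraphs *)

Section InducedSubgraphs.
Variables (V : finType) (G : sgraph V).
Implicit Types (A B C : {set V}) (u v w r x y : V).

Definition edges_in A : {set {set V}} := [set e in edges G | e \subset A].
Definition matchings A : nat := nearly 0 (edges_in A).
Definition near1 A : nat := nearly 1 (edges_in A).
Definition nbrs A v : {set V} := [set x in A | G v x].
(** The number of matchings of A that cover r, sorted by the partner x of r.
    If a new leaf u is attached to r, this is also the number of subsets whose
    only adjacent pair is formed by ur and another edge at r. *)
Definition fan A r : nat := \sum_(x in nbrs A r) matchings (A :\ r :\ x).

Lemma adjC x y : G x y = G y x.
Proof. exact: adj_sym. Qed.

Lemma adj_neq x y : G x y -> x != y.
Proof. by apply: contraTneq => ->; rewrite adj_irrefl. Qed.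

Lemma edges_inP A e :
  reflect (exists x y, [/\ e = [set x; y], x \in A, y \in A & G x y])
    (e \in edges_in A).
Proof.
rewrite inE; apply: (iffP andP) => [[/imsetP[[x y]]]|[x [y [-> xA yA xy]]]].
  rewrite inE /= => xy -> s; exists x, y.
  by split=> //; apply: (subsetP s); rewrite !inE eqxx ?orbT.
split; last by rewrite subUset !sub1set xA.
by apply/imsetP; exists (x, y); rewrite ?inE.
Qed.

Lemma mem_edge A x y : x \in A -> y \in A -> G x y -> [set x; y] \in edges_in A.
Proof. by move=> xA yA xy; apply/edges_inP; exists x, y. Qed.

Lemma Z1E : Z1 G = near1 setT.
Proof.
rewrite /Z1 /near1 /nearly; apply: eq_card => I; rewrite !inE /nearly_independent1.
congr ((I \subset pred_of_set _) && _); apply/setP=> e; by rewrite inE subsetT andbT.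
Qed.

Lemma away_edges_in A e : away e (edges_in A) = edges_in (A :\: e).
Proof.
apply/setP=> f; rewrite in_set; apply/idP/idP.
  case/and3P=> /edges_inP[x [y [-> xA yA xy]]] ne.
  rewrite /adjacent_edges eq_sym ne /= => /existsPn nx.
  apply: mem_edge => //; [move: (nx x)|move: (nx y)];
    by rewrite !inE ?xA ?yA eqxx ?orbT ?andbT.
case/edges_inP=> x [y [-> xA yA xy]].
have no z : z \in [set x; y] -> z \notin e.
  by move: xA yA; rewrite !inE => /andP[xe _] /andP[ye _] /orP[] /eqP->.
have xxy : x \in [set x; y] by rewrite !inE eqxx.
have [ne nadj] := apart_edges xxy no; rewrite ne adjacent_edgesC nadj !andbT.
by move: xA yA; rewrite !in_setD => /andP[_ xA] /andP[_ yA]; apply: mem_edge.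
Qed.

(** An edge adjacent to rw contains exactly one of r and w: a simple graph has
    no second edge on the same two vertices. *)
Lemma sum_edges_at A r w (F : {set V} -> nat) : r \in A -> w \in A -> G r w ->
  \sum_(f in edges_in A | adjacent_edges [set r; w] f) F f =
  \sum_(x in nbrs (A :\ w) r) F [set r; x] + \sum_(x in nbrs (A :\ r) w) F [set w; x].
Proof.
move=> rA wA rw; rewrite (bigID (fun f : {set V} => r \in f)) /=.
have inj z x y : x != z -> [set z; x] = [set z; y] -> x = y.
  move=> xz /setP/(_ x); rewrite !inE eqxx orbT (negPf xz) /=.
  by move/esym/eqP.
have half a b (P : pred {set V}) : a \in A -> G a b ->
    (forall f, P f = [&& f \in edges_in A, f != [set a; b] & a \in f]) ->
    \sum_(f | P f) F f = \sum_(x in nbrs (A :\ b) a) F [set a; x].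
  move=> aA ab defP; rewrite -[RHS](big_imset F) /=; last first.
    move=> x y; rewrite !inE => /andP[_ ax] /andP[_ ay].
    by apply: inj; rewrite eq_sym adj_neq.
  apply: eq_bigl => f; rewrite defP; apply/and3P/imsetP.
  - case=> /edges_inP[x [y [-> xA yA xy]]] ne; rewrite !inE => /orP[] /eqP aE; subst a.
      exists y => //; rewrite !inE yA xy !andbT; by apply: contraNneq ne => ->.
    exists x; last by rewrite setUC.
    rewrite !inE xA adjC xy !andbT; by apply: contraNneq ne => ->; rewrite setUC.
  - case=> x xn ->; have /andP[/andP[xb xA] ax] : (x != b) && (x \in A) && G a x.
      by move: xn; rewrite !inE.
    split; first exact: mem_edge.
      apply: contraNneq xb => /setP/(_ x); rewrite !inE eqxx orbT => /esym/orP[] // /eqP xa.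
      by rewrite xa adj_irrefl in ax.
    by rewrite !inE eqxx.
congr (_ + _).
  apply: (half r w) => // f; rewrite -andbA; congr andb.
  rewrite /adjacent_edges eq_sym -andbA; congr andb.
  case rf: (r \in f); rewrite ?andbF // andbT; apply/existsP; exists r.
  by rewrite rf !inE eqxx.
apply: half; rewrite // 1?adjC // => f; rewrite -andbA; case fE: (f \in _) => //=.
have [x [y [fxy _ _ _]]] := edges_inP _ _ fE.
rewrite /adjacent_edges [[set w; r]]setUC eq_sym; case: eqVneq => //= ne.
apply/andP/idP=> [[/existsP[z /andP[]]]|wf].
  by rewrite !inE => /orP[] /eqP-> // ->.
split; first by apply/existsP; exists w; rewrite wf !inE eqxx orbT.
apply: contra ne; move: wf; rewrite fxy !inE => /orP[] /eqP wx /orP[] /eqP rx; subst w r.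
- by rewrite adj_irrefl in rw.
- by rewrite setUC.
- by [].
- by rewrite adj_irrefl in rw.
Qed.

Lemma edges_in_bipart B C : (forall x y, x \in B -> y \in C -> ~~ G x y) ->
  edges_in (B :|: C) = edges_in B :|: edges_in C.
Proof.
move=> sep; apply/setP=> e; rewrite in_setU; apply/edges_inP/orP.
  case=> x [y [->]]; rewrite !in_setU => /orP[xB|xC] /orP[yB|yC] xy.
  - by left; apply: mem_edge.
  - by case/negP: (sep x y xB yC).
  - by case/negP: (sep y x yB xC); rewrite adjC.
  - by right; apply: mem_edge.
by case=> /edges_inP[x [y [-> xB yB xy]]]; exists x, y; rewrite !inE xB yB ?orbT.
Qed.

Lemma union_counts B C : (forall x y, x \in B -> y \in C -> ~~ G x y) ->
  matchings (B :|: C) = matchings B * matchings C /\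
  near1 (B :|: C) = near1 B * matchings C + matchings B * near1 C.
Proof.
move=> sep; rewrite /matchings /near1 edges_in_bipart //; apply: nearlyU => e f.
case/edges_inP=> x [y [-> xB yB xy]] /edges_inP[a [b [-> aC bC ab]]].
have no z : z \in [set x; y] -> z \notin [set a; b].
  rewrite !inE negb_or => /orP[] /eqP->; apply/andP; split; apply/eqP=> e1; subst.
  - by move: (sep _ _ yB aC); rewrite adjC xy.
  - by move: (sep _ _ yB bC); rewrite adjC xy.
  - by move: (sep _ _ xB aC); rewrite xy.
  - by move: (sep _ _ xB bC); rewrite xy.
by apply: (@apart_edges _ _ _ x _ no); rewrite !inE eqxx.
Qed.

Lemma fan_union B C r : r \in C -> r \notin B -> (forall x y, x \in B -> y \in C -> ~~ G x y) ->
  fan (B :|: C) r = matchings B * fan C r.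
Proof.
move=> rC rB sep; rewrite /fan big_distrr /=.
have -> : nbrs (B :|: C) r = nbrs C r.
  apply/setP=> x; rewrite !inE; case xB: (x \in B) => //=.
  by move: (sep x r xB rC); rewrite adjC => /negPf->; rewrite andbF.
apply: eq_bigr => x; rewrite inE => /andP[xC rx].
have xB : x \notin B by apply/negP=> xB; move: (sep x r xB rC); rewrite adjC rx.
have -> : (B :|: C) :\ r :\ x = B :|: C :\ r :\ x.
  apply/setP=> z; rewrite !inE; case: (eqVneq z x) => [->|zx]; first by rewrite (negPf xB).
  by case: (eqVneq z r) => [->|zr] //=; rewrite (negPf rB).
apply: (union_counts _).1 => y z yB; rewrite !inE => /and3P[_ _ zC]; exact: sep.
Qed.

(** Two rooted subgraphs (B, w) and (C, r) are joined by the edge rw and the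
    result is rooted at r.  The edge recurrence at rw reduces every count to
    products, because removing rw, or r and w, separates the two sides. *)
Section Join.
Variables (B C : {set V}) (w r : V).
Hypotheses (wB : w \in B) (rC : r \in C) (disBC : [disjoint B & C]).
Hypothesis cross : forall x y, x \in B -> y \in C -> G x y = (x == w) && (y == r).

Let wC : w \notin C. Proof. by rewrite (disjointFr disBC wB). Qed.
Let rB : r \notin B. Proof. by rewrite (disjointFl disBC rC). Qed.
Let rw : G r w. Proof. by rewrite adjC cross // !eqxx. Qed.
Let BCne x y : x \in B -> y \in C -> x != y.
Proof. by move=> xB yC; apply: contraTneq xB => ->; rewrite (disjointFl disBC yC). Qed.

Let sepr x y : x \in B -> y \in C :\ r -> ~~ G x y.
Proof. by rewrite in_setD1 => xB /andP[yr yC]; rewrite cross // (negPf yr) andbF. Qed.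
Let sepwr x y : x \in B :\ w -> y \in C :\ r -> ~~ G x y.
Proof. by rewrite in_setD1 => /andP[_]; exact: sepr. Qed.

Let rem_r : (B :|: C) :\ r = B :|: C :\ r.
Proof. by apply/setP=> z; rewrite !inE; case: eqVneq => [->|_] //=; rewrite (negPf rB). Qed.
Let rem_rw : (B :|: C) :\ r :\ w = B :\ w :|: C :\ r.
Proof.
rewrite rem_r; apply/setP=> z; rewrite !inE; case: (eqVneq z w) => [->|_] //=.
by rewrite (negPf wC) andbF.
Qed.

Lemma join_edges : edges_in (B :|: C) :\ [set r; w] = edges_in B :|: edges_in C.
Proof.
apply/setP=> e; rewrite in_setU in_setD1; apply/andP/orP.
- case=> ne /edges_inP[x [y [eE]]]; rewrite !in_setU => /orP[xB|xC] /orP[yB|yC] xy.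
  + by left; rewrite eE mem_edge.
  + move: ne; rewrite eE; move: xy; rewrite cross // => /andP[/eqP-> /eqP->].
    by rewrite setUC eqxx.
  + move: ne; rewrite eE; move: xy; rewrite adjC cross // => /andP[/eqP-> /eqP->].
    by rewrite eqxx.
  + by right; rewrite eE mem_edge.
- case=> /edges_inP[x [y [-> xA yA xy]]]; split.
  + have : r \notin [set x; y].
      by rewrite !inE negb_or ![r == _]eq_sym !BCne.
    by apply: contraNneq => ->; rewrite !inE eqxx.
  + by apply: mem_edge; rewrite ?inE ?xA ?yA.
  + have : w \notin [set x; y] by rewrite !inE negb_or !BCne.
    by apply: contraNneq => ->; rewrite !inE eqxx orbT.
  + by apply: mem_edge; rewrite ?inE ?xA ?yA ?orbT.
Qed.

(** In the third identity the summands correspond to the subsets without rw,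
    those with rw outside the adjacent pair, and those whose pair contains
    rw, the other edge of the pair being at r or at w. *)
Lemma join_counts :
  [/\ matchings (B :|: C) =
         matchings B * matchings C + matchings (B :\ w) * matchings (C :\ r),
      matchings ((B :|: C) :\ r) = matchings B * matchings (C :\ r),
      near1 (B :|: C) =
         near1 B * matchings C + matchings B * near1 C
       + (near1 (B :\ w) * matchings (C :\ r) + matchings (B :\ w) * near1 (C :\ r))
       + (matchings (B :\ w) * fan C r + fan B w * matchings (C :\ r)),
      near1 ((B :|: C) :\ r) = near1 B * matchings (C :\ r) + matchings B * near1 (C :\ r)
    & fan (B :|: C) r = matchings (B :\ w) * matchings (C :\ r) + matchings B * fan C r].
Proof.
have rA : r \in B :|: C by rewrite inE rC orbT.
have wA : w \in B :|: C by rewrite inE wB.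
have eE : [set r; w] \in edges_in (B :|: C) by apply: mem_edge.
have [UB UZ] := union_counts sepr.
have [UwB UwZ] := union_counts sepwr.
have sepE e f : e \in edges_in B -> f \in edges_in C -> e != f /\ ~~ adjacent_edges e f.
  case/edges_inP=> x [y [-> xB yB xy]] /edges_inP[a [b [-> aC bC ab]]].
  have no z : z \in [set x; y] -> z \notin [set a; b].
    by rewrite !inE negb_or => /orP[] /eqP->; rewrite !BCne.
  by apply: (@apart_edges _ _ _ x _ no); rewrite !inE eqxx.
have [E0 E1] := nearlyU sepE.
have nC : nbrs ((B :|: C) :\ w) r = nbrs C r.
  apply/setP=> x; rewrite !inE; case: (eqVneq x w) => [->|xw] /=.
    by rewrite (negPf wC).
  case xB: (x \in B) => //=; rewrite adjC cross // (negPf xw) /= andbC.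
  by rewrite (disjointFr disBC xB).
have nB : nbrs ((B :|: C) :\ r) w = nbrs B w.
  apply/setP=> x; rewrite !inE; case: (eqVneq x r) => [->|xr] /=.
    by rewrite (negPf rB).
  case xC: (x \in C) => //=; last by rewrite orbF.
  by rewrite cross // (negPf xr) !andbF.
split=> //.
- by rewrite /matchings (nearly0_edge eE) join_edges E0 away_edges_in -setDDl rem_rw -UwB.
- by rewrite rem_r.
- rewrite /near1 (nearly1_edge eE) join_edges E1 away_edges_in -setDDl rem_rw.
  rewrite -/(near1 (B :\ w :|: C :\ r)) UwZ.
  congr (_ + _ + _); rewrite sum_edges_at // nC nB; congr (_ + _).
    rewrite /fan big_distrr; apply: eq_bigr => x xn /=.
    have xC : x \in C by move: xn; rewrite inE => /andP[].
    rewrite away_edges_in -/(matchings _).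
    have -> : (B :\ w :|: C :\ r) :\: [set r; x] = B :\ w :|: C :\ r :\ x.
      apply/setP=> z; rewrite !inE; case zB: (z \in B); last first.
        by case: (z == r); case: (z == x); case: (z == w).
    by rewrite (disjointFr disBC zB) !andbF negb_or (BCne zB rC) (BCne zB xC) ?orbF ?andbT.
    apply: (union_counts _).1 => y z yB; rewrite in_setD1 => /andP[_]; exact: sepwr.
  rewrite /fan big_distrl; apply: eq_bigr => x xn /=.
  have xB : x \in B by move: xn; rewrite inE => /andP[].
  rewrite away_edges_in -/(matchings _).
  have -> : (B :\ w :|: C :\ r) :\: [set w; x] = B :\ w :\ x :|: C :\ r.
    apply/setP=> z; rewrite !inE; case zC: (z \in C); last first.
      by case: (z == r); case: (z == x); case: (z == w); rewrite ?andbF ?orbF.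
    by rewrite (disjointFl disBC zC) !andbF negb_or ![z == _]eq_sym (BCne wB zC) (BCne xB zC).
  apply: (union_counts _).1 => y z; rewrite in_setD1 => /andP[_]; exact: sepwr.
- by rewrite rem_r.
- rewrite /fan (bigD1 w) /=; last by rewrite !inE wB rw.
  rewrite rem_rw UwB big_distrr; congr (_ + _).
  transitivity (\sum_(x in nbrs C r) matchings ((B :|: C) :\ r :\ x)).
    apply: eq_bigl => x; rewrite -nC !inE; case: (x == w); rewrite ?andbF ?andbT //.
  apply: eq_bigr => x xn /=.
  have xC : x \in C by move: xn; rewrite inE => /andP[].
  have -> : (B :|: C) :\ r :\ x = B :|: C :\ r :\ x.
    rewrite rem_r; apply/setP=> z; rewrite !inE; case zB: (z \in B) => //=.
    by rewrite BCne.
  apply: (union_counts _).1 => y z yB; rewrite in_setD1 => /andP[_]; exact: sepr.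
Qed.
End Join.
End InducedSubgraphs.

(** * The counts of a path *)

Fixpoint path_matchings n : nat :=
  if n is n1.+1 then if n1 is n2.+1 then path_matchings n1 + path_matchings n2 else 1 else 1.
(** The case n.+3 is the pendant edge recurrence at an end of the path. *)
Fixpoint path_near1 n : nat :=
  if n is n1.+1 then
    if n1 is n2.+1 then
      if n2 is n3.+1 then path_near1 n1 + path_near1 n2 + path_matchings n3 else 0
    else 0
  else 0.

Lemma path_matchingsS n : path_matchings n.+2 = path_matchings n.+1 + path_matchings n.
Proof. by []. Qed.
Lemma path_near1S n : path_near1 n.+3 = path_near1 n.+2 + path_near1 n.+1 + path_matchings n.
Proof. by []. Qed.

Lemma path_matchings_gt0 n : 0 < path_matchings n.
Proof. by elim/ltn_ind: n => -[|[|n]] IH //; rewrite path_matchingsS addn_gt0 IH. Qed.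

Lemma leq_path_matchings : {homo path_matchings : m n / m <= n}.
Proof.
by apply: homo_leq => // [y x z|[|n]]; [exact: leq_trans | | rewrite path_matchingsS leq_addr].
Qed.

Lemma path_matchings_lt n : path_matchings n.+1 < path_matchings n.+2.
Proof. by rewrite path_matchingsS -addn1 leq_add2l path_matchings_gt0. Qed.

Lemma path_matchings_near1 n : 4 <= n -> (path_matchings n).+1 < path_near1 n.+2.
Proof.
elim/ltn_ind: n => -[|[|[|[|[|[|n]]]]]] // IH _.
have := IH n.+4 ltac:(lia) ltac:(lia).
have := IH n.+1.+4 ltac:(lia) ltac:(lia).
rewrite (path_near1S n.+1.+4) (path_matchingsS n.+4); lia.
Qed.

Lemma path_near1_gt0 n : 3 <= n -> 0 < path_near1 n.
Proof.
by case: n => [|[|[|n]]] // _; rewrite path_near1S addn_gt0 path_matchings_gt0 orbT.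
Qed.

(** With N the order of A - u - v and N - j the number of further leaves
    at v, the left side bounds z(A) - z(A - u) and allows for the possible
    excess of one over the path on j vertices; the right side is its value for
    the path.  Increasing N by one with j fixed adds f(j) on the left and at
    least as much on the right, so only j = N - 1 needs a separate argument. *)
Lemma many_leaves_bound N j : 8 <= N -> j < N ->
  path_near1 j + (N - j) * path_matchings j + path_matchings j.-1 + 1 <
  path_near1 N + path_matchings N.-1.
Proof.
elim: N => // N IH; rewrite leq_eqVlt => /orP[/eqP <-|N8].
  by move: j {IH}; do 8 (move=> [|j] //; move: j).
rewrite ltnS leq_eqVlt => /orP[/eqP ->|jN].
  rewrite subSnn mul1n; case: N {IH} N8 => [|[|[|N]]] // N8.
  rewrite (path_near1S N.+1) [_.-1]/= [_.-1]/= (path_matchingsS N.+1) (path_matchingsS N).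
  have := @path_matchings_near1 N ltac:(lia); lia.
have := IH N8 jN; rewrite subSn ?mulSn; last exact: ltnW.
case: N N8 jN {IH} => [|[|[|N]]] // N8 jN.
rewrite (path_near1S N.+1) [_.-1]/= [N.+4.-1]/= (path_matchingsS N.+1) (path_matchingsS N).
have : path_matchings j <= path_matchings N.+2 by apply: leq_path_matchings; rewrite -ltnS.
rewrite (path_matchingsS N); have := leq_path_matchings (leqnSn N); lia.
Qed.

(** * Pendant vertices of a forest *)

Section Leaf.
Variables (V : finType) (G : sgraph V).
Implicit Types (A B C L : {set V}) (u v w r x y : V) (s : seq V).

Lemma nbrsP A v x : (x \in nbrs G A v) = (x \in A) && G v x.
Proof. by rewrite inE. Qed.

Lemma edgeless_counts A : (forall x y, x \in A -> y \in A -> ~~ G x y) ->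
  matchings G A = 1 /\ near1 G A = 0.
Proof.
move=> no; have E0 : edges_in G A = set0.
  apply/setP=> e; rewrite in_set0; apply/negP=> /edges_inP[x [y [_ xA yA xy]]].
  by move: (no x y xA yA); rewrite xy.
by rewrite /matchings /near1 E0 !nearly_set0.
Qed.

Lemma edgeless_or_edge A :
  (matchings G A = 1 /\ near1 G A = 0) \/ exists x y, [/\ x \in A, y \in A & G x y].
Proof.
have [/existsP[x /existsP[y /and3P[xA yA xy]]]|no] :=
    boolP [exists x, [exists y, [&& x \in A, y \in A & G x y]]].
  by right; exists x, y.
left; apply: edgeless_counts => x y xA yA; move/existsPn/(_ x): no.
by move/existsPn/(_ y); rewrite xA yA.
Qed.

Lemma set1_counts u : [/\ matchings G [set u] = 1, matchings G ([set u] :\ u) = 1,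
  near1 G [set u] = 0, near1 G ([set u] :\ u) = 0 & fan G [set u] u = 0].
Proof.
have no A : A \subset [set u] -> matchings G A = 1 /\ near1 G A = 0.
  move/subsetP=> s; apply: edgeless_counts => x y /s; rewrite inE => /eqP-> /s.
  by rewrite inE => /eqP->; rewrite adj_irrefl.
have [-> ->] := no _ (subxx _); have [-> ->] := no _ (subD1set [set u] u).
split=> //; rewrite /fan big_pred0 // => x; rewrite nbrsP inE.
by case: eqP => [->|]; rewrite ?adj_irrefl.
Qed.

Lemma leaf_nbr A u v : u \in A -> nbrs G A u = [set v] ->
  [/\ v \in A :\ u, G u v, #|A :\ u| = #|A :\ u :\ v|.+1 & #|A| = #|A :\ u :\ v|.+2].
Proof.
move=> uA nu; have : v \in nbrs G A u by rewrite nu inE.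
rewrite nbrsP => /andP[vA uv].
have vB : v \in A :\ u by rewrite !inE vA eq_sym (adj_neq uv).
by split=> //; rewrite ?(cardsD1 u A) ?uA (cardsD1 v (A :\ u)) vB.
Qed.

(** This is the join of the single vertex u with the rest of A. *)
Lemma leaf_counts A u v : u \in A -> nbrs G A u = [set v] ->
  matchings G A = matchings G (A :\ u) + matchings G (A :\ u :\ v) /\
  near1 G A = near1 G (A :\ u) + near1 G (A :\ u :\ v) + fan G (A :\ u) v.
Proof.
move=> uA nu; have [vC uv _ _] := leaf_nbr uA nu.
have uB : u \in [set u] by rewrite inE.
have dis : [disjoint [set u] & A :\ u] by rewrite disjoints1 !inE eqxx.
have cross x y : x \in [set u] -> y \in A :\ u -> G x y = (x == u) && (y == v).
  rewrite !inE => /eqP-> /andP[_ yA]; rewrite eqxx /=.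
  by have := nbrsP A u y; rewrite nu yA inE => ->.
have [m1 m2 z1 z2 f0] := set1_counts u.
have [Jm _ Jz _ _] := join_counts uB vC dis cross.
move: Jm Jz; rewrite setD1K // m1 m2 z1 z2 f0 => -> ->; split; lia.
Qed.

(** Both counts depend on the edges only, so isolated vertices can be dropped;
    this is how the order of the subgraph decreases when v has many leaves. *)
Lemma remove_isolated A L : (forall x, x \in L -> nbrs G A x = set0) ->
  edges_in G (A :\: L) = edges_in G A.
Proof.
move=> iso; apply/setP=> e; apply/edges_inP/edges_inP.
  by case=> x [y [-> ]]; rewrite !in_setD => /andP[_ xA] /andP[_ yA]; exists x, y.
case=> x [y [-> xA yA xy]]; exists x, y; rewrite !in_setD xA yA xy !andbT; split=> //.
  by apply/negP=> /iso /setP/(_ y); rewrite nbrsP yA xy inE.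
by apply/negP=> /iso /setP/(_ x); rewrite nbrsP xA adjC xy inE.
Qed.

Hypothesis forestG : is_forest G.

Lemma forest_no_cycle r x p : G r x -> path G x p -> uniq [:: r, x & p] ->
  G (last x p) r -> p = [::].
Proof.
move=> rx xp un lr; case: p xp un lr => // y p xp un lr; case: forestG.
exists [:: r, x, y & p]; split=> //; rewrite /ucycle un andbT.
by rewrite (cycle_path r) /= lr rx.
Qed.

Definition simple_path A s := [&& uniq s, sorted G s & all (mem A) s].

(** Another neighbour y of u would prolong the path if it lay outside, and
    close a cycle if it lay on it. *)
Lemma longest_head A u v p : simple_path A [:: u, v & p] ->
  (forall s, simple_path A s -> size s <= (size p).+2) -> nbrs G A u = [set v].
Proof.
move=> ch mx; case/and3P: (ch) => un srt /= /and3P[uA vA pA].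
have /andP[uv vp] : G u v && path G v p := srt.
apply/setP=> y; rewrite nbrsP in_set1; apply/andP/eqP=> [[yA uy]|->] //.
apply: contraTeq isT => yv.
have uy' : y != u by rewrite eq_sym (adj_neq uy).
case yp: (y \in p); last first.
  suff /mx : simple_path A [:: y, u, v & p] by rewrite /= ltnn.
  apply/and3P; split; last by rewrite /= yA uA vA.
    by rewrite [uniq _]/= !inE (negPf uy') (negPf yv) yp.
  by rewrite /= adjC uy uv.
case/splitPr: yp un vp {mx ch pA srt} => p1 p2 un vp.
have: rcons p1 y = [::].
  apply: (forest_no_cycle uv).
  - by move: vp; rewrite -cat_rcons cat_path => /andP[].
  - by move: un; rewrite -cat_rcons -!cat_cons cat_uniq => /andP[].
  - by rewrite last_rcons adjC.
by case: (p1).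
Qed.

(** Take a longest path u, v, w and so on.  Replacing u by any neighbour of v
    outside the path gives another longest path, so that neighbour is a leaf
    too; a neighbour further along the path would close a cycle.  If the path
    stops at v, then w := v is a harmless choice, since v is not its own
    neighbour. *)
Lemma penultimate A : (exists x y, [/\ x \in A, y \in A & G x y]) ->
  exists u v w, [/\ u \in A, nbrs G A u = [set v], w != u
    & forall x, x \in nbrs G A v -> x != w -> nbrs G A x = [set v]].
Proof.
case=> x [y [xA yA xy]].
pose P k := [exists t : k.-tuple V, simple_path A t].
have P2 : P 2.
  apply/existsP; exists [tuple x; y].
  by rewrite /simple_path /= inE xy xA yA (adj_neq xy).
have bP k : P k -> k <= #|V|.
  case/existsP=> t /and3P[un _ _].
  by rewrite -(size_tuple t) -(card_uniqP un) max_card.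
have [k /existsP[t cht] mx] := ex_maxnP (ex_intro _ 2 P2) bP.
have k2 := mx 2 P2.
have mxs s : simple_path A s -> size s <= k.
  by move=> chs; apply: mx; apply/existsP; exists (in_tuple s).
have := size_tuple t; move: k2 cht mxs; case: (tval t) => [|u [|v p]] k2 ch mxs sk;
  rewrite -sk in k2 mxs; rewrite // {sk k2 mx} in ch mxs *.
case/and3P: (ch) => un srt /= /and3P[uA vA pA].
have /andP[uv vp] : G u v && path G v p := srt.
have nu := longest_head ch mxs.
exists u, v, (head v p); split=> //.
  case: p un {vp ch mxs pA srt} => [|w p]; rewrite /= !inE ?negb_or; first by rewrite eq_sym andbT.
  by rewrite [w == u]eq_sym; case/andP=> /and3P[].
move=> z; rewrite nbrsP => /andP[zA vz] zw.
have [->//|zu] := eqVneq z u.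
have zv : z != v by rewrite eq_sym (adj_neq vz).
have zp : z \notin p.
  apply/negP; case: p zw vp un {pA ch mxs srt} => //= w p zw /andP[vw wp] /andP[_ un].
  rewrite inE (negPf zw) /= => zp; case/splitPr: zp wp un => p1 p2 wp un.
  have: rcons p1 z = [::].
    apply: (forest_no_cycle vw).
    - by move: wp; rewrite -cat_rcons cat_path => /andP[].
    - move: un; rewrite -cat_rcons -!cat_cons -[_ && _]/(uniq (_ :: _)) -cat_cons.
      by rewrite cat_uniq => /andP[].
    - by rewrite last_rcons adjC.
  by case: (p1).
apply: (@longest_head A z v p) => //.
apply/and3P; split; last by rewrite /= zA vA pA.
  by move: un; rewrite /= !inE !negb_or zv zp => /andP[_ ->].
by rewrite /= adjC vz vp.
Qed.
End Leaf.

(** * Forests with the most matchings *)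

Section InducedPaths.
Variables (V : finType) (G : sgraph V).
Implicit Types (A B C L : {set V}) (u v w r x y : V) (s : seq V).

(** Consecutive vertices are adjacent and there are no chords.  The formulation
    by positions matches the adjacency of the standard path and is stable under
    reversal. *)
Definition induced_path s : Prop := uniq s /\
  forall x0 i j, i < size s -> j < size s ->
    G (nth x0 s i) (nth x0 s j) = (i.+1 == j) || (j.+1 == i).

Lemma induced_path_tail x s : induced_path (x :: s) -> induced_path s.
Proof.
case=> /andP[_ un] adjs; split=> // x0 i j si sj.
by have /= -> := adjs x0 i.+1 j.+1 si sj.
Qed.

Lemma induced_path_rev s : induced_path s -> induced_path (rev s).
Proof.
case=> un adjs; split=> [|x0 i j]; first by rewrite rev_uniq.
rewrite size_rev => si sj; rewrite !nth_rev // adjs; lia.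
Qed.

Lemma induced_path_head x s : induced_path (x :: s) ->
  nbrs G [set y in x :: s] x = [set y in take 1 s].
Proof.
case=> un adjs; apply/setP=> y; rewrite nbrsP !in_set.
have xs : x \notin take 1 s by apply/negP=> /mem_take; apply/negP; case/andP: un.
rewrite inE; have [->|yx] /= := eqVneq y x; first by rewrite adj_irrefl (negPf xs).
case: s un adjs {xs} => [|z s] un adjs; first by [].
have [ys|ys] := boolP (y \in z :: s); last first.
  by rewrite /= take0 inE; apply/esym; apply: contraNF ys => /eqP->; rewrite inE eqxx.
have yi : (index y (z :: s)).+1 < size [:: x, z & s] by move: ys; rewrite -index_mem.
have yE : nth x [:: x, z & s] (index y (z :: s)).+1 = y := nth_index x ys.
have := adjs x 0 _ (ltn0Sn _) yi; rewrite yE => -> /=.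
by rewrite take0 inE orbF eqSS [y == z]eq_sym; case: (z == y).
Qed.

Lemma induced_path_cons u v s : u \notin v :: s -> induced_path (v :: s) ->
  nbrs G (u |: [set y in v :: s]) u = [set v] -> induced_path [:: u, v & s].
Proof.
move=> us [un adjs] nu; split; first by rewrite cons_uniq us.
have Gu x0 j : j < size (v :: s) -> G u (nth x0 (v :: s) j) = (j == 0).
  move=> sj; have ys : nth x0 (v :: s) j \in v :: s by rewrite mem_nth.
  have := nbrsP G (u |: [set y in v :: s]) u (nth x0 (v :: s) j).
  rewrite nu in_setU1 in_set ys orbT /= in_set1 => <-.
  by rewrite -(nth_uniq x0 sj (ltn0Sn _) un).
move=> x0 [|i] [|j] si sj.
- by rewrite adj_irrefl.
- by rewrite [LHS]Gu //; case: j {sj}.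
- by rewrite adjC [LHS]Gu //; case: i {si}.
- by rewrite [LHS]adjs.
Qed.

Definition is_path A : Prop := exists2 s, induced_path s & A = [set x in s].

Lemma set_cons x s : x \notin s -> [set y in x :: s] :\ x = [set y in s].
Proof.
by move=> xs; apply/setP=> y; rewrite !inE; case: eqVneq => [->|] //=; rewrite (negPf xs).
Qed.

Lemma path_counts s : induced_path s ->
  matchings G [set x in s] = path_matchings (size s) /\
  near1 G [set x in s] = path_near1 (size s).
Proof.
have [n] := ubnP (size s); elim: n s => // n IH [|x [|y s]] sn ps.
- by rewrite set_nil; apply: edgeless_counts => ? ?; rewrite inE.
- have [m1 _ z1 _ _] := set1_counts G x.
  by have -> : [set y in [:: x]] = [set x] by apply/setP=> z; rewrite !inE.
have xA : x \in [set z in [:: x, y & s]] by rewrite !inE eqxx.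
have pys := induced_path_tail ps; have pss := induced_path_tail pys.
have nx : nbrs G [set z in [:: x, y & s]] x = [set y].
  by rewrite induced_path_head //=; apply/setP=> z; rewrite take0 !inE.
have [-> ->] := leaf_counts xA nx.
case: (ps) => /andP[xs /andP[ys _]] _; rewrite !set_cons //.
have [-> ->] := IH (y :: s) sn pys.
have [-> ->] := IH s (ltnW sn) pss.
split=> //; rewrite /fan induced_path_head //.
case: s pss sn {ps pys nx xs xA} ys => [|z s] pss sn ys.
  by rewrite big_pred0 // => z; rewrite !inE.
rewrite /= take0 (big_pred1 z) => [|t]; last by rewrite !inE.
have zs : z \notin s by case: pss => /andP[].
rewrite !set_cons //.
by have [-> _] := IH s (ltnW (ltnW sn)) (induced_path_tail pss).
Qed.

(** An interior vertex of the path A - u has two neighbours there, so v is an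
    end, and reversing the path if necessary it is the first vertex. *)
Lemma is_path_cons A u v : u \in A -> nbrs G A u = [set v] -> is_path (A :\ u) ->
  #|nbrs G (A :\ u) v| <= 1 -> is_path A.
Proof.
move=> uA nu [s ps As] dv.
have [vAu _ _ _] := leaf_nbr uA nu.
have memS z : (z \in s) = (z \in A :\ u) by rewrite As in_set.
have vs : v \in s by rewrite memS.
have us : u \notin s by rewrite memS !inE eqxx.
suff [t pt st] : exists2 t, induced_path (v :: t) & s =i v :: t.
  exists [:: u, v & t].
    apply: induced_path_cons => //; first by rewrite -st.
    rewrite -nu; congr nbrs; rewrite -(setD1K uA) As; congr (_ |: _).
    by apply/setP=> z; rewrite !in_set st.
  by rewrite -(setD1K uA) As; apply/setP=> z; rewrite in_setU1 !in_set [in RHS]in_cons -st.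
case: (ps) => un adjs.
set i := index v s; have si : i < size s by rewrite index_mem.
have iv : nth v s i = v by rewrite nth_index.
have head_v t : induced_path t -> s =i t -> 0 < size t -> nth v t 0 = v ->
    exists2 t, induced_path (v :: t) & s =i v :: t.
  by case: t => // a t pt st _ /= av; exists t; rewrite -av.
have [i0|i0] := posnP i.
  by apply: (head_v s) => //; [exact: leq_ltn_trans si | rewrite -{1}i0].
have [il|il] := eqVneq i.+1 (size s).
  apply: (head_v (rev s)); first exact: induced_path_rev.
  - by move=> z; rewrite mem_rev.
  - by rewrite size_rev (leq_ltn_trans _ si).
  - by rewrite nth_rev -?il // subSS subn0.
have si1 : i.+1 < size s by rewrite ltn_neqAle il.
have si2 : i.-1 < size s by lia.
have nb : [set nth v s i.-1; nth v s i.+1] \subset nbrs G (A :\ u) v.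
  rewrite subUset !sub1set !nbrsP -!memS !mem_nth //=.
  by rewrite -{1}iv -{3}iv !adjs //; lia.
move: (leq_trans (subset_leq_card nb) dv); rewrite cards2 nth_uniq //.
by have -> : i.-1 != i.+1 by lia.
Qed.

Hypothesis forestG : is_forest G.

(** The bound is the pendant edge recurrence.  In case of equality A - u is a
    path, and v has at most one neighbour in it: otherwise one of two neighbours
    would be a leaf z, isolated in A - u - v, and A - u - v would have at most
    as many matchings as the path with one vertex less. *)
Lemma matchings_leq A : matchings G A <= path_matchings #|A| /\
  (matchings G A = path_matchings #|A| -> is_path A).
Proof.
have [n] := ubnP #|A|; elim: n A => // n IH A /ltnSE leA.
have [[-> _]|edge] := edgeless_or_edge G A.
  split; first exact: path_matchings_gt0.
  move=> cA; have : #|A| < 2.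
    case: #|A| cA => [|[|k]] // e; have := path_matchings_lt k; rewrite -e.
    by have := path_matchings_gt0 k.+1; lia.
  rewrite cardE => sA; exists (enum A); last by apply/setP=> z; rewrite in_set mem_enum.
  split=> [|x0 i j si sj]; first exact: enum_uniq.
  have -> : i = 0 by lia.
  have -> : j = 0 by lia.
  by rewrite adj_irrefl.
have [u [v [w [uA nu wu pen]]]] := penultimate forestG edge.
have [vB uv cB cA] := leaf_nbr uA nu.
have [-> _] := leaf_counts uA nu.
have [|le1 eq1] := IH (A :\ u); first by rewrite cA in leA; rewrite cB.
have [|le2 _] := IH (A :\ u :\ v); first by rewrite cA in leA; exact: ltnW.
rewrite cA path_matchingsS -cB; split; first exact: leq_add.
move=> eqm.
have {}eq1 : is_path (A :\ u) by apply: eq1; move: le1 le2 eqm; clear; lia.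
have eq2 : matchings G (A :\ u :\ v) = path_matchings #|A :\ u :\ v|.
  by move: le1 le2 eqm; clear; lia.
apply: (is_path_cons uA nu eq1); rewrite leqNgt; apply/negP.
case/card_gt1P=> a [b [aN bN ab]].
(* Of two neighbours of v other than u, at least one differs from w. *)
have [z zN zw] : exists2 z, z \in nbrs G (A :\ u) v & z != w.
  have [aw|] := eqVneq a w; last by exists a.
  by exists b => //; rewrite -aw eq_sym.
have zB : z \in A :\ u :\ v.
  by move: zN; rewrite nbrsP => /andP[zAu vz]; rewrite in_setD1 zAu eq_sym (adj_neq vz).
have nz : nbrs G A z = [set v].
  by apply: pen => //; move: zN; rewrite !nbrsP in_setD1 => /andP[/andP[_ ->]].
have two : 1 < #|A :\ u :\ v|.
  apply/card_gt1P; exists a, b; split=> //.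
    by move: aN; rewrite nbrsP !inE => /andP[-> va]; rewrite eq_sym (adj_neq va).
  by move: bN; rewrite nbrsP !inE => /andP[-> vb]; rewrite eq_sym (adj_neq vb).
have iso x' : x' \in [set z] -> nbrs G (A :\ u :\ v) x' = set0.
  rewrite in_set1 => /eqP->; apply/setP=> t; rewrite nbrsP !in_setD1 in_set0.
  have := nbrsP G A z t; rewrite nz in_set1; case: (t == v); case: (t == u) => //=.
have cz := cardsD1 z (A :\ u :\ v); rewrite zB in cz.
have [|le3 _] := IH (A :\ u :\ v :\ z).
  apply: leq_ltn_trans (subset_leq_card (subD1set _ _)) _.
  by rewrite cA in leA; exact: ltnW.
have le4 : path_matchings #|A :\ u :\ v| <= path_matchings #|A :\ u :\ v :\ z|.
  by rewrite -eq2 /matchings -(remove_isolated iso).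
have cz0 : 0 < #|A :\ u :\ v :\ z| by move: two; rewrite cz add1n ltnS.
rewrite leqNgt cz add1n in le4; move: cz0 le4.
by case: #|pred_of_set (_ :\ z)| => // k _; rewrite path_matchings_lt.
Qed.
End InducedPaths.

(** * Forests of order at most nine *)

(** The quintuple m(A), m(A - r), z(A), z(A - r) and the fan of A at r. *)
Definition profile_type := (nat * nat * nat * nat * nat)%type.

(** p belongs to the part that contains the root of the result. *)
Definition profile_join (p q : profile_type) : profile_type :=
  let: (m1, d1, z1, y1, f1) := p in let: (m2, d2, z2, y2, f2) := q in
  (m2 * m1 + d2 * d1, m2 * d1,
   z2 * m1 + m2 * z1 + (y2 * d1 + d2 * y1) + (d2 * f1 + f2 * d1),
   z2 * d1 + m2 * y1, d2 * d1 + m2 * f1).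

Definition profile_union (p q : profile_type) : profile_type :=
  let: (m1, d1, z1, y1, f1) := p in let: (m2, d2, z2, y2, f2) := q in
  (m2 * m1, m2 * d1, z2 * m1 + m2 * z1, z2 * d1 + m2 * y1, m2 * f1).

Definition add_new (T : eqType) (s : seq T) (x : T) := if x \in s then s else x :: s.

Definition combine_profiles (ps qs : seq profile_type) : seq profile_type :=
  [seq profile_join p q | p <- ps, q <- qs] ++ [seq profile_union p q | p <- ps, q <- qs].

(** Entry i of T lists profiles of order i.+1.  Pairing T with its reversal
    gives all ways to split the next order into two positive parts. *)
Definition candidates (T : seq (seq profile_type)) : seq profile_type :=
  flatten [seq combine_profiles c.1 c.2 | c <- zip T (rev T)].

(** Removing duplicates keeps the lists short: 330 profiles at order 8. *)
Fixpoint profile_tables n : seq (seq profile_type) :=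
  if n is n'.+1 then
    let T := profile_tables n' in rcons T (foldl (@add_new _) [::] (candidates T))
  else [:: [:: (1, 1, 0, 0, 0)]].

(** The excess of one is attained for the orders 4 to 7.  At order 8 several
    forests reach the value of the path, so nothing is claimed about equality. *)
Definition counts_ok n m z : bool :=
  if n <= 7 then z <= (path_near1 n).+1 else
  (z <= path_near1 n) && ((n == 8) || ((z == path_near1 n) ==> (m == path_matchings n))).

Definition profile_ok n (p : profile_type) : bool :=
  let: (m, _, z, _, _) := p in counts_ok n m z.

Lemma small_profiles_ok :
  let T := profile_tables 7 in
  all (profile_ok 9) (candidates T) &&
  all (fun k => all (profile_ok k.+1) (nth [::] T k)) (iota 0 8).
Proof. by vm_compute. Qed.

Lemma mem_add_new (T : eqType) (s t : seq T) : foldl (@add_new _) s t =i s ++ t.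
Proof.
elim: t s => [|x t IH] s y; first by rewrite cats0.
rewrite /= IH !mem_cat inE /add_new; case: ifP => [xs|_].
  by case: eqVneq => [->|] //=; rewrite xs.
by rewrite inE orbCA orbA.
Qed.

Lemma size_profile_tables n : size (profile_tables n) = n.+1.
Proof. by elim: n => //= n IH; rewrite size_rcons IH. Qed.

Section RootedForests.
Variables (V : finType) (G : sgraph V).
Hypothesis forestG : is_forest G.
Implicit Types (A B C : {set V}) (w r x y : V).

Definition profile A r : profile_type :=
  (matchings G A, matchings G (A :\ r), near1 G A, near1 G (A :\ r), fan G A r).

(** If r has a neighbour w, let B be the component of w in A - r.  A second edge
    between r and B would close a cycle through w.  If r has no neighbour,
    the vertex r is split off alone. *)
Lemma rooted_split A r : r \in A -> 1 < #|A| -> exists B C w,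
  [/\ A = B :|: C, [disjoint B & C], w \in B, r \in C
    & (forall x y, x \in B -> y \in C -> G x y = (x == w) && (y == r)) \/
      (forall x y, x \in B -> y \in C -> ~~ G x y)].
Proof.
move=> rA cA; have [nr|[w]] := set_0Vmem (nbrs G A r).
  have /card_gt0P[w wA] : 0 < #|A :\ r| by move: cA; rewrite (cardsD1 r A) rA.
  exists (A :\ r), [set r], w; split=> //.
  - by rewrite setUC setD1K.
  - by rewrite disjoint_sym disjoints1 !inE eqxx.
  - by rewrite inE.
  right=> x y; rewrite in_setD1 in_set1 => /andP[_ xA] /eqP->.
  by have := nbrsP G A r x; rewrite nr in_set0 xA /= adjC => <-.
rewrite nbrsP => /andP[wA rw].
pose e := [rel x y | [&& G x y, x \in A :\ r & y \in A :\ r]].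
have wr : w \in A :\ r by rewrite !inE wA eq_sym (adj_neq rw).
have pathA x p : x \in A :\ r -> path e x p -> all (mem (A :\ r)) (x :: p) && path G x p.
  elim: p x => [|y p IH] x xA; first by rewrite /= xA.
  case/andP=> /and3P[xy _ yA] /(IH _ yA)/andP[pA pG].
  by rewrite [all _ _]/= -/(all _ (y :: p)) pA xA [path _ _ _]/= xy pG.
pose B := [set x | connect e w x].
have BA x : x \in B -> x \in A :\ r.
  rewrite inE => /connectP[p /(pathA _ _ wr)/andP[pA _] ->].
  by have := allP pA _ (mem_last w p).
exists B, (A :\: B), w; split.
- apply/setP=> x; rewrite in_setU in_setD; case: (boolP (x \in B)) => //= /BA.
  by rewrite inE => /andP[_ ->].
- by rewrite disjoints_subset; apply/subsetP=> x xB; rewrite in_setC in_setD xB.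
- by rewrite inE connect0.
- by rewrite in_setD rA andbT; apply/negP=> /BA; rewrite !inE eqxx.
left=> x y xB; rewrite in_setD => /andP[yB yA].
have [->|yr] := eqVneq y r; last first.
  rewrite andbF; apply/negP=> xy; case/negP: yB; rewrite inE.
  have xA := BA x xB; rewrite inE in xB; apply: connect_trans xB (connect1 _).
  by rewrite /= xy xA in_setD1 yr yA.
rewrite andbT; have [->|xw] := eqVneq x w; first by rewrite adjC.
apply/negP=> xr; move: (xB); rewrite inE => /connectP[p0 p0e xE].
case/shortenP: p0e xE => p pe un _ xE.
have /andP[pA pG] := pathA _ _ wr pe.
have: p = [::].
  apply: (forest_no_cycle forestG rw pG); last by rewrite -xE.
  rewrite [uniq _]/= -/(uniq (w :: p)) un andbT; apply/negP=> /(allP pA).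
  by rewrite !inE eqxx.
by move=> p0'; move: xw; rewrite xE p0' eqxx.
Qed.

Lemma profile_combine B C w r : [disjoint B & C] -> w \in B -> r \in C ->
    (forall x y, x \in B -> y \in C -> G x y = (x == w) && (y == r)) \/
      (forall x y, x \in B -> y \in C -> ~~ G x y) ->
  profile (B :|: C) r \in
    [:: profile_join (profile C r) (profile B w); profile_union (profile C r) (profile B w)].
Proof.
move=> dis wB rC [cross|sep]; rewrite inE mem_seq1; apply/orP; [left|right]; apply/eqP;
  rewrite /profile.
  by have [-> -> -> -> ->] := join_counts wB rC dis cross.
have rB : r \notin B by rewrite (disjointFl dis rC).
have [-> ->] := union_counts sep.
have -> : (B :|: C) :\ r = B :|: C :\ r.
  by apply/setP=> z; rewrite !inE; case: eqVneq => [->|_] //=; rewrite (negPf rB).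
have [|-> ->] := @union_counts _ G B (C :\ r).
  by move=> x y xB; rewrite in_setD1 => /andP[_]; exact: sep.
by rewrite fan_union.
Qed.

Lemma profile_in_candidates n A r :
  (forall B w, w \in B -> #|B| <= n.+1 ->
     profile B w \in nth [::] (profile_tables n) #|B|.-1) ->
  r \in A -> #|A| = n.+2 -> profile A r \in candidates (profile_tables n).
Proof.
move=> IH rA cA.
have [|B [C [w [AE dis wB rC crossing]]]] := rooted_split rA; first by rewrite cA.
have cBC : #|B| + #|C| = n.+2 by rewrite -cA AE cardsU (disjoint_setI0 dis) cards0 subn0.
have cB : 0 < #|B| by apply/card_gt0P; exists w.
have cC : 0 < #|C| by apply/card_gt0P; exists r.
apply/flattenP; pose T := profile_tables n.
exists (combine_profiles (nth [::] T #|C|.-1) (nth [::] T #|B|.-1)).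
  apply/mapP; exists (nth [::] T #|C|.-1, nth [::] T #|B|.-1) => //.
  have sT := size_profile_tables n.
  have -> : nth [::] T #|B|.-1 = nth [::] (rev T) #|C|.-1.
    rewrite nth_rev sT; last by lia.
    congr nth; lia.
  rewrite -nth_zip ?size_rev // mem_nth // size_zip size_rev minnn sT; lia.
have pB := IH _ _ wB ltac:(lia); have pC := IH _ _ rC ltac:(lia).
have := profile_combine dis wB rC crossing; rewrite -AE !inE => /orP[] /eqP->.
  by rewrite mem_cat; apply/orP; left; apply: allpairs_f.
by rewrite mem_cat; apply/orP; right; apply: allpairs_f.
Qed.

Lemma profile_in_tables n A r : r \in A -> #|A| <= n.+1 ->
  profile A r \in nth [::] (profile_tables n) #|A|.-1.
Proof.
elim: n A r => [|n IH] A r rA.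
  move=> cA; have AE : A = [set r].
    by apply/eqP; rewrite eq_sym eqEcard sub1set rA cards1.
  have [m1 m2 z1 z2 f0] := set1_counts G r.
  by rewrite AE /profile cards1 m1 m2 z1 z2 f0.
rewrite leq_eqVlt => /orP[/eqP cA|cA].
  rewrite cA [profile_tables _]/= nth_rcons size_profile_tables ltnn eqxx mem_add_new.
  exact: profile_in_candidates.
rewrite /= nth_rcons size_profile_tables; case: ifP => [_|/negbT]; first exact: IH.
have : 0 < #|A| by apply/card_gt0P; exists r.
lia.
Qed.

Lemma small_counts A : 0 < #|A| <= 9 ->
  counts_ok #|A| (matchings G A) (near1 G A).
Proof.
case/andP=> /card_gt0P[r rA] cA.
have /andP[/allP ok9 /allP okn] := small_profiles_ok.
(* At order 9 the candidates are tested directly: tabulating them would only add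
   the cost of removing duplicates. *)
have [c9|c9] := eqVneq #|A| 9.
  rewrite c9; have := ok9 (profile A r); apply.
  by apply: profile_in_candidates => // B w; exact: profile_in_tables.
have c8 : #|A| <= 8 by rewrite -ltnS ltn_neqAle c9.
have cA0 : 0 < #|A| by apply/card_gt0P; exists r.
have /okn/allP/(_ (profile A r)) : #|A|.-1 \in iota 0 8 by rewrite mem_iota; lia.
rewrite prednK //; apply; exact: profile_in_tables.
Qed.
End RootedForests.

(** * The extremal forest *)

Section Extremal.
Variables (V : finType) (G : sgraph V).
Hypothesis forestG : is_forest G.
Implicit Types (A B C : {set V}) (w r x y : V).

(** Let L be the set of neighbours of v other than u and w; they are all leaves.
    If L is empty the second case holds.  Otherwise the terms of the fan at v for
    members of L are all m(A - u - v), every other count is unchanged when L is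
    removed, and the first case holds with B = A - u. *)
Lemma pendant_dichotomy A : 10 <= #|A| -> (exists x y, [/\ x \in A, y \in A & G x y]) ->
  (forall B, B \proper A -> near1 G B <= (path_near1 #|B|).+1) ->
  (exists B, [/\ B \proper A, #|B|.+1 = #|A| &
     near1 G A < near1 G B + path_near1 #|A|.-2 + path_matchings #|A|.-2.-1]) \/
  (exists u v w, [/\ u \in A, nbrs G A u = [set v], nbrs G (A :\ u) v \subset [set w]
     & near1 G A = near1 G (A :\ u) + near1 G (A :\ u :\ v) + fan G (A :\ u) v]).
Proof.
move=> cA edge IH.
have [u [v [w [uA nu wu pen]]]] := penultimate forestG edge.
have [vB uv cAu cB] := leaf_nbr uA nu; pose B := A :\ u :\ v.
have [_ zA] := leaf_counts uA nu.
pose L := nbrs G (A :\ u) v :\ w.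
have [L0|Ln] := eqVneq L set0.
  right; exists u, v, w; split=> //.
  by rewrite -setD_eq0 -/L L0.
left; exists (A :\ u); split; [exact: properD1 | by rewrite cAu cB |].
have LB x : x \in L -> x \in B.
  rewrite in_setD1 nbrsP => /and3P[_ xA vx].
  by rewrite /B in_setD1 xA eq_sym (adj_neq vx).
have iso C x : C \subset B -> x \in L -> nbrs G C x = set0.
  move=> CB; rewrite in_setD1 nbrsP => /and3P[xw xA vx].
  have nx : nbrs G A x = [set v].
    by apply: pen => //; rewrite nbrsP vx andbT; move: xA; rewrite in_setD1 => /andP[].
  apply/setP=> t; rewrite nbrsP in_set0; apply/negP=> /andP[/(subsetP CB)].
  rewrite /B !in_setD1 => /and3P[tv _ tA] xt.
  by move: (nbrsP G A x t); rewrite nx in_set1 tA xt (negPf tv).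
have remL C : C \subset B -> edges_in G (C :\: L) = edges_in G C.
  by move=> CB; apply: remove_isolated => x; exact: iso.
pose d := #|L|; have d0 : 0 < d by rewrite card_gt0.
have cBL : #|B :\: L| = #|B| - d.
  rewrite cardsD; congr (_ - _); apply: eq_card => x; rewrite in_setI.
  by case xL: (x \in L); rewrite ?andbF // (LB x xL).
have dB : d <= #|B| by apply: subset_leq_card; apply/subsetP.
have mL C : C \subset B -> matchings G C <= path_matchings #|C :\: L|.
  by move=> CB; rewrite /matchings -(remL C CB); have [] := matchings_leq forestG (C :\: L).
(* The neighbours in L contribute the first summand and w, if it is a neighbour,
   the second. *)
have fanb : fan G (A :\ u) v <= d * path_matchings (#|B| - d) + path_matchings (#|B| - d).-1.
  rewrite /fan (bigID (pred1 w)) [leqRHS]addnC /= leq_add //; last first.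
    rewrite -sum_nat_const (eq_bigl (mem L)) => [|x]; last first.
      by rewrite -[RHS]/(x \in L) in_setD1 andbC.
    apply: leq_sum => x xL; apply: leq_trans (mL _ (subD1set _ _)) _.
    by apply: leq_path_matchings; rewrite -cBL subset_leq_card // setSD // subD1set.
  have [wn|wn] := boolP (w \in nbrs G (A :\ u) v); last first.
    by rewrite big_pred0 // => x; case: eqVneq => [->|]; rewrite ?andbF // (negPf wn).
  rewrite (big_pred1 w) => [|x]; last by rewrite andb_idl //= => /eqP->.
  apply: leq_trans (mL _ (subD1set _ _)) _; apply: leq_path_matchings.
  have wBL : w \in B :\: L.
    move: wn; rewrite nbrsP => /andP[wA vw].
    by rewrite in_setD in_setD1 eqxx /= in_setD1 wA eq_sym (adj_neq vw).
  rewrite -cBL (cardsD1 w (B :\: L)) wBL /= subset_leq_card //.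
  by apply/subsetP=> x; rewrite !in_setD !in_set1 => /and3P[-> -> ->].
have zB : near1 G B <= (path_near1 (#|B| - d)).+1.
  rewrite /near1 -(remL B (subxx _)) -cBL; apply: IH.
  apply: sub_proper_trans (properD1 uA).
  by apply: subset_trans (subsetDl _ _) _; exact: subD1set.
have N8 : 8 <= #|B| by rewrite -2!ltnS -cB.
have jB : #|B| - d < #|B| by rewrite ltn_subrL d0; apply: leq_trans N8.
have := many_leaves_bound N8 jB; rewrite subKn // zA cB -[_.-2]/#|B| -/B; lia.
Qed.

(** The last clause is weaker than uniqueness of the path, but it is inherited
    by the recurrence through arithmetic alone: z(A) = a(n) forces equality in
    all three terms, z(A - u) = a(n-1) gives m(A - u) = f(n-1) by induction,
    and m(A - u - v - w) = f(n-3) then determines m(A - u - v).  Thus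
    equality is never passed on to the order n - 2, which may be 8, where other
    forests attain a(8) too. *)
Lemma near1_leq A :
  [/\ near1 G A <= (path_near1 #|A|).+1,
      8 <= #|A| -> near1 G A <= path_near1 #|A|
    & 9 <= #|A| -> near1 G A = path_near1 #|A| -> matchings G A = path_matchings #|A| ].
Proof.
have [n] := ubnP #|A|; elim: n A => // n IH A /ltnSE leA.
have [c9|c10] := leqP #|A| 9.
  have [c0|c0] := posnP #|A|.
    have [] := @edgeless_counts _ G A; last by rewrite c0 => _ ->.
    by move=> x y; rewrite (cards0_eq c0) inE.
  have := small_counts forestG (introT andP (conj c0 c9)); rewrite /counts_ok.
  have [c8 z|c8 /andP[z zm]] := leqP #|A| 7.
    by split=> // h; suff: false by []; move: h c8; clear; lia.
  split=> //; first exact: leqW.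
  move=> c9' e; apply/eqP; move: zm; rewrite e eqxx /= => /orP[/eqP c|//].
  by rewrite c in c9'.
have [[_ ->]|edge] := edgeless_or_edge G A.
  by split=> // _ e; have := @path_near1_gt0 #|A| ltac:(lia); rewrite -e.
have IHp B : B \proper A -> #|B| < n by move/proper_card => h; exact: leq_trans leA.
have [||[B [BA cB zA]]|[u [v [w [uA nu sw zA]]]]] := pendant_dichotomy c10.
- exact: edge.
- by move=> B /IHp/IH[].
- have [_ zB _] := IH B (IHp B BA).
  have {}zB : near1 G B <= path_near1 #|A|.-1.
    by rewrite -cB /= zB //; rewrite -ltnS cB ltnW // ltnW.
  have : near1 G A < path_near1 #|A|.
    by move: c10 zB zA; case: #|A| => [|[|[|k]]] // _; rewrite path_near1S; simpl predn; lia.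
  by move=> lt; split=> [||_ e]; [exact/ltnW/ltnW | move=> _; exact: ltnW | rewrite e ltnn in lt].
have pB : A :\ u \proper A by exact: properD1.
have [vB uv cAu cB] := leaf_nbr uA nu; pose B := A :\ u :\ v.
rewrite -/B in cAu cB.
have BA : B \proper A by exact: sub_proper_trans (subD1set _ _) pB.
have [_ z1 e1] := IH _ (IHp _ pB); have [_ z2 _] := IH _ (IHp _ BA).
have c8 : 8 <= #|B| by rewrite -2!ltnS -cB.
have {}z1 := z1 ltac:(rewrite cAu; exact: leqW); have {}z2 := z2 c8.
have {}e1 := e1 ltac:(by rewrite cAu).
have fanE : fan G (A :\ u) v = 0 \/
    (nbrs G (A :\ u) v = [set w] /\ fan G (A :\ u) v = matchings G (B :\ w)).
  rewrite /fan; move: sw; rewrite subset1 => /orP[] /eqP nE; rewrite nE.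
    by right; split=> //; rewrite big_set1.
  by left; rewrite big_set0.
have f0 := path_matchings_gt0 #|B|.-1.
have aE : path_near1 #|A| = path_near1 #|B|.+1 + path_near1 #|B| + path_matchings #|B|.-1.
  by rewrite cB; case: #|B| c8 => // k _; rewrite path_near1S.
rewrite aE zA -/B cAu in z1 e1 *.
case: fanE => [->|[nv ->]].
  by split; move: z1 z2 f0; clear; lia.
have wB : w \in B.
  have : w \in nbrs G (A :\ u) v by rewrite nv inE.
  by rewrite nbrsP => /andP[wA vw]; rewrite in_setD1 wA eq_sym (adj_neq vw).
have cBw : #|B :\ w| = #|B|.-1 by rewrite (cardsD1 w B) wB.
have [mBw _] := matchings_leq forestG (B :\ w); rewrite cBw in mBw.
have zle : near1 G (A :\ u) + near1 G B + matchings G (B :\ w) <=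
    path_near1 #|B|.+1 + path_near1 #|B| + path_matchings #|B|.-1 by rewrite !leq_add.
split=> [||_ e]; [exact: leqW | by move=> _ |].
have zu : near1 G (A :\ u) = path_near1 #|B|.+1.
  by move: e z1 z2 mBw; clear; lia.
have mw : matchings G (B :\ w) = path_matchings #|B|.-1.
  by move: e z1 z2 mBw; clear; lia.
have [mA _] := leaf_counts uA nu; have [mAu _] := leaf_counts vB nv.
have := e1 zu; rewrite mAu -/B => eB; rewrite mA mAu -/B cB path_matchingsS.
move: eB; case: #|B| c8 mw => // k _; rewrite path_matchingsS /= => ->; clear; lia.
Qed.
End Extremal.

Lemma is_path_isomorphic n (V : finType) (F : sgraph V) : #|V| = n ->
  is_path F [set: V] <-> isomorphic F (path_graph n).
Proof.
move=> cV; split.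
  case=> s [un adjs] sT.
  have sz : size s = n.
    by rewrite -cV -(card_uniqP un) -cardsT sT; apply: eq_card => x; rewrite inE.
  have ms x : x \in s by have := in_setT x; rewrite sT inE.
  have ix x : index x s < n by rewrite -sz index_mem.
  exists (fun x => Ordinal (ix x)); split.
    apply: inj_card_bij; last by rewrite card_ord cV.
    by move=> x y [exy]; rewrite -(nth_index x (ms x)) exy nth_index.
  move=> x y; rewrite /= /path_adj /=.
  by rewrite -[in RHS](nth_index x (ms x)) -[in RHS](nth_index x (ms y)) adjs ?sz.
case=> f [[g fK gK] fadj].
exists [seq g i | i <- enum 'I_n]; last first.
  by apply/setP=> x; rewrite !inE; apply/esym/mapP; exists (f x); rewrite ?mem_enum.
split=> [|x0 i j]; first by rewrite map_inj_uniq ?enum_uniq //; exact: can_inj gK.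
rewrite size_map size_enum_ord => hi hj.
have sz k : k < n -> k < size (enum 'I_n) by rewrite size_enum_ord.
rewrite (nth_map (Ordinal hi) _ _ (sz _ hi)) (nth_map (Ordinal hi) _ _ (sz _ hj)) -fadj !gK.
have adjE (a b : 'I_n) : path_graph n a b = (a.+1 == b :> nat) || (b.+1 == a :> nat) by [].
by rewrite adjE !nth_enum_ord.
Qed.

Theorem theorem5 (n : nat) (hn : 9 <= n) (V : finType) (F : sgraph V)
    (hV : #|V| = n) (hF : is_forest F) :
  Z1 F <= Z1 (path_graph n) /\
  (Z1 F = Z1 (path_graph n) <-> isomorphic F (path_graph n)).
Proof.
have iso_counts (W : finType) (H : sgraph W) : #|W| = n -> is_path H [set: W] ->
    Z1 H = path_near1 n.
  move=> cW [s ps sT]; rewrite Z1E sT (path_counts ps).2 -cW -cardsT sT cardsE.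
  by case: ps => /card_uniqP ->.
have Zn : Z1 (path_graph n) = path_near1 n.
  apply: iso_counts; first exact: card_ord.
  apply/is_path_isomorphic; first exact: card_ord.
  by exists id; split=> //; exists id.
rewrite Zn; split.
  rewrite Z1E; have [_ + _] := near1_leq hF [set: V].
  by rewrite cardsT hV => -> //; exact: ltnW.
rewrite -is_path_isomorphic //; split=> [|/iso_counts]; last exact.
rewrite Z1E => e; have [_ _] := near1_leq hF [set: V].
rewrite cardsT hV => /(_ hn e) m.
by apply: (matchings_leq hF _).2; rewrite cardsT hV.
Qed.
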